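(* Let $n \in \mathbb{N}$ and $k \in \mathbb{N}\setminus\{0\}$. Then $F(GT(n,k)) = \max(Ap(GT(n,k),s_0)) - s_0$, and the maximal element $M=\max(Ap(GT(n,k),s_0))$ and the Frobenius number $F=F(GT(n,k))$ are given as follows. 1. If $n=0$: $M=s_1$ and $F=s_1-2$. 2. If $n\neq 0$ and $k=1$: $M=s_n+s_{n+1}$ and $F=s_n+s_{n+1}-s_0$. 3. If $2\le k<n$: $M=t_1s_1+\cdots+t_{n-2}s_{n-2}+s_{n-1}+s_{n+k}$ and $F=t_1s_1+\cdots+t_{n-2}s_{n-2}+s_{n-1}+s_{n+k}-s_0$, where $t_1,\dots,t_{n-2}$ are such that $(t_1,\dots,t_{n-2},1,0,\dots,0,1)\in A(n,\delta)$ (with entry $1$ in positions $n-1$ and $n+k$, and $0$ in positions $n,\dots,n+k-1$) and $\sum_{i=1}^{n-2}(2^i-1)t_i=2^{n-1}-2^k+2$. 4. If $n=k\ge 1$: $M=s_1+s_{2n}$ and $F=s_1+s_{2n}-s_0$. 5. If $n\neq 0$, $k>n$ and $k\neq 2$: $M=t_1s_1+\cdots+t_{k-1}s_{k-1}+s_k+s_{k+1}+\cdots+s_{n+k-1}$ and $F=t_1s_1+\cdots+t_{k-1}s_{k-1}+s_k+\cdots+s_{n+k-1}-s_0$, where $t_1,\dots,t_{k-1}$ are such that $(t_1,\dots,t_{k-1},1,\dots,1)\in A(n,\delta)$ (with entry $1$ in positions $k,\dots,n+k-1$) and $\sum_{i=1}^{k-1}(2^i-1)t_i=2^n+n$. 6.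 If $n=1$ and $k=2$: $M=74$ and $F=67$.
   Context: $\mathbb{N}$ is the set of nonnegative integers. $s_i=(2^k+1)\cdot 2^{n+i}-(2^k-1)$ for $i\in\mathbb{N}$, and $GT(n,k)=\langle\{s_i : i\in\mathbb{N}\}\rangle$ is the submonoid of $(\mathbb{N},+)$ generated by the $s_i$ (the generalized Thabit numerical semigroup). For a numerical semigroup $S$ (a submonoid of $(\mathbb N,+)$ with finite complement), $F(S)$ is the greatest integer not belonging to $S$ (Frobenius number), and for $x\in S\setminus\{0\}$ the Apéry set is $Ap(S,x)=\{s\in S : s-x\notin S\}$. Put $\delta=1$ if $n=0$; $\delta=k$ if $n\neq0$ and $k\le n$; $\delta=k-1$ if $n\neq 0$ and $k>n$. $A(n,\delta)$ is the set of sequences $(t_1,\dots,t_{n+\delta})\in\{0,1,2\}^{n+\delta}$ such that $t_{n+\delta}\in\{0,1\}$ and, for every $j$, if $t_j=2$ then $t_i=0$ for all $i<j$. *)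

(* Defs.v *)
From mathcomp Require Import all_boot all_order all_algebra.
From mathcomp Require Import boolp classical_sets.

Set Implicit Arguments.
Unset Strict Implicit.
Unset Printing Implicit Defensive.

Local Open Scope classical_set_scope.
Local Open Scope nat_scope.

Definition submonoid (S : set nat) : Prop :=
  S 0 /\ forall x y, S x -> S y -> S (x + y).

Definition gen_submonoid (G : set nat) : set nat := smallest submonoid G.

Definition is_max d (T : porderType d) (A : set T) (m : T) : Prop :=
  A m /\ ubound A m.

(* The differences s - x and the Frobenius number (which is -1 for S = N) live
   in int, so S is transported along the embedding Posz. *)
Definition Apery (S : set nat) (x : nat) : set nat :=
  [set s | S s /\ ~ (Posz @` S) (s%:Z - x%:Z)%R].

Definition is_Frobenius (S : set nat) (F : int) : Prop :=
  is_max (~` (Posz @` S)) F.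

(* Both subtractions are exact in nat, since 1 <= 2 ^ k and
   2 ^ k - 1 <= (2 ^ k + 1) * 2 ^ (n + i). *)
Definition thabit (n k i : nat) : nat :=
  (2 ^ k + 1) * 2 ^ (n + i) - (2 ^ k - 1).

Definition GT (n k : nat) : set nat := gen_submonoid (range (thabit n k)).

Definition delta (n k : nat) : nat :=
  if n == 0 then 1 else if k <= n then k else k - 1.

(* 1-based: the sequence (t_1, ..., t_m) is the list t of size m, and
   t_j = entry t j for 1 <= j <= m. *)
Definition entry (t : seq nat) (j : nat) : nat := nth 0 t (j - 1).

Definition admissible (n d : nat) (t : seq nat) : Prop :=
  [/\ size t = n + d,
      forall j, 1 <= j <= n + d -> entry t j \in [:: 0; 1; 2],
      entry t (n + d) \in [:: 0; 1]
    & forall j, 1 <= j <= n + d -> entry t j = 2 ->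
        forall i, 1 <= i < j -> entry t i = 0].

(* Main.v *)
(* Put c_i = 2^i - 1, a = (2^k + 1) 2^n and s = s_0, so that s_i = s + a c_i
   and a = s + c_k.  Let g w be the number of terms in the greedy
   decomposition of w into the c_i with i >= 1; g is subadditive and
   g w <= g (w + 1) + 1.  Hence GT(n, k) is the set of all s q + v w with
   v w = s g w + a w, and v is increasing.  As a is prime to s, the Apery set of
   s is {v w : w < s}, with maximum v (s - 1).  The sequences of A(n, delta) are
   greedy decompositions, and in each of the six cases the given combination
   has weight s - 1 in the c_i. *)
Require Import Defs.
From mathcomp Require Import all_boot all_order all_algebra zify ring.
From mathcomp Require Import boolp classical_sets.

Local Open Scope nat_scope.

(** * Mersenne numbers and greedy decompositions *)

Definition mersenne (i : nat) : nat := 2 ^ i - 1.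

Lemma mersenneS i : mersenne i.+1 = (mersenne i).*2.+1.
Proof. by rewrite /mersenne expnS; have := expn_gt0 2 i; lia. Qed.

Lemma mersenne_gt0 i : 0 < mersenne i.+1.
Proof. by rewrite mersenneS. Qed.

Lemma leq_mersenne i j : i <= j -> mersenne i <= mersenne j.
Proof. by move=> le_ij; rewrite leq_sub2r // leq_exp2l. Qed.

Lemma geq_mersenne i : i <= mersenne i.
Proof. by elim: i => // i; rewrite mersenneS; lia. Qed.

(** As c_(p+2) = 2 c_(p+1) + 1, the bound on x makes c_(p+1) the largest Mersenne number not above
    w, which is the greedy choice. *)
Lemma mersenne_decomp w : 0 < w ->
  exists p x, w = mersenne p.+1 + x /\ x <= mersenne p.+1.
Proof.
elim: w => // -[_ _|w IHw _]; first by exists 0, 0.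
have [//|p [x [-> le_x]]] := IHw.
have [lt_x|ge_x] := ltnP x (mersenne p.+1).
  by exists p, x.+1; rewrite addnS.
by exists p.+1, 0; split=> //; rewrite (mersenneS p.+1); lia.
Qed.

Lemma mersenne_ind (P : nat -> Prop) :
  P 0 ->
  (forall p x, x <= mersenne p.+1 ->
     (forall y, y < mersenne p.+1 + x -> P y) -> P (mersenne p.+1 + x)) ->
  forall w, P w.
Proof.
move=> P0 PS w; elim/ltn_ind: w => -[//|w] IHw.
have [//|p [x [def_w le_x]]] := @mersenne_decomp w.+1.
by rewrite def_w in IHw *; apply: PS.
Qed.

(* The quotients need no cap: below [mersenne m.+1] they are at most 2. *)
Fixpoint greedy_upto (m w : nat) : nat :=
  if m is m'.+1 then w %/ mersenne m + greedy_upto m' (w %% mersenne m) else 0.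

Definition greedy (w : nat) : nat := greedy_upto w w.

(** Indices whose Mersenne number exceeds w contribute quotient 0, so every large enough start gives
    the same count. *)
Lemma greedyE p w : w < mersenne p.+1 -> greedy w = greedy_upto p w.
Proof.
have small q m : w < mersenne q.+1 -> greedy_upto (m + q) w = greedy_upto q w.
  move=> lt_w; elim: m => //= m IHm.
  have lt_w' : w < mersenne (m + q).+1.
    by apply: leq_trans lt_w (leq_mersenne _ _ _); rewrite ltnS leq_addl.
  by rewrite divn_small // modn_small.
move=> lt_w; have lt_ww : w < mersenne w.+1 by rewrite geq_mersenne.
by rewrite /greedy -(small w p) // addnC small.
Qed.

(** Evaluated from index [p.+1], the first quotient rises by one and the remainder is unchanged; x =
    c_(p+1) yields the digit 2. *)
Lemma greedyD p x :
  x <= mersenne p.+1 -> greedy (mersenne p.+1 + x) = (greedy x).+1.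
Proof.
move=> le_x; have defC := mersenneS p.+1.
rewrite (greedyE p.+1 x) ?(greedyE p.+1) /=; try by lia.
by rewrite divnDl ?dvdnn // divnn mersenne_gt0 modnDl.
Qed.

Lemma greedy_mersenne p : greedy (mersenne p.+1) = 1.
Proof. by rewrite -[mersenne _]addn0 greedyD. Qed.

Lemma greedy_mersenne2 p : greedy (mersenne p.+1).*2 = 2.
Proof. by rewrite -addnn greedyD // greedy_mersenne. Qed.

(** * Subadditivity of the greedy length *)

(** Stripping common leading terms reduces to w + 1 = c_(p+1), where w = 2 c_p has two terms, or
    none if p = 0. *)
Lemma greedy_leS w : greedy w <= (greedy w.+1).+1.
Proof.
elim/ltn_ind: w => w IHw.
have [//|p [x [def_w le_x]]] := @mersenne_decomp w.+1.
case: x le_x def_w => [_|x lt_x] def_w.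
  move: def_w; rewrite addn0 mersenneS => -[->].
  rewrite -mersenneS greedy_mersenne; case: p => // p.
  by rewrite greedy_mersenne2.
have -> : w = mersenne p.+1 + x by lia.
rewrite -addnS !greedyD ?ltnS //; last exact: ltnW.
by apply: IHw; have := mersenne_gt0 p; lia.
Qed.

Lemma greedy_leD w d : greedy w <= greedy (w + d) + d.
Proof.
elim: d => [|d IHd]; first by rewrite !addn0.
by apply: leq_trans IHd _; rewrite !addnS -addSn leq_add2r greedy_leS.
Qed.

(* With c_p the leading term of c_p + w, adding c_i overflows to the leading
   term c_(p+1) = 2 c_p + 1 and leaves the remainder w + c_i - c_p - 1. *)
Lemma greedy_carry i m w :
  mersenne (i + m).+1 < w + mersenne i.+1 -> w <= mersenne (i + m).+1 ->
  greedy (w + mersenne i.+1 - (mersenne (i + m).+1).+1) <= (greedy w).+1.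
Proof.
elim: m w => [|m IHm] w; rewrite ?addn0 ?addnS => lt_w.
  (* In the base case the remainder is w - 1. *)
  move=> _; case: w lt_w => [|w _]; first by rewrite ltnn.
  by rewrite addSn subSS addnK greedy_leS.
(* If w is the Mersenne number itself, the remainder is c_(i+1) - 1, which has at most two terms. *)
rewrite leq_eqVlt => /orP[/eqP ->|lt_w'].
  rewrite (mersenneS (i + m).+1) in lt_w *.
  have := greedy_leS (mersenne i.+1).-1.
  rewrite prednK ?mersenne_gt0 // greedy_mersenne -mersenneS greedy_mersenne.
  by congr (greedy _ <= _); lia.
have := mersenneS (i + m).+1; move: lt_w lt_w'.
have := @leq_mersenne i.+1 (i + m).+1; rewrite ltnS leq_addr => /(_ isT).
set C := mersenne (i + m).+2; set D := mersenne (i + m).+1 in IHm *.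
move=> le_i lt_w lt_w' defC.
(* The remainder is one less than the one left by w' at the previous index; [greedy_leS] costs one
   term, which the term D of w pays for. *)
have [w' def_w] : exists w', w = D + w' by exists (w - D); lia.
have le_w' : w' <= D by lia.
have IH : greedy (w' + mersenne i.+1 - D.+1) <= (greedy w').+1.
  by apply: IHm => //; lia.
rewrite def_w greedyD //.
apply: leq_trans (greedy_leS _) _; rewrite ltnS.
by apply: leq_trans IH; apply: eq_leq; congr greedy; lia.
Qed.

(** Either c_(i+1) exceeds w and becomes the leading term, or it is absorbed by the remainder x
    under the old leading term, or it overflows as in [greedy_carry]. *)
Lemma greedy_leD_mersenne i w : greedy (w + mersenne i.+1) <= (greedy w).+1.
Proof.
elim/mersenne_ind: w => [|p x le_x IHx]; first by rewrite greedy_mersenne.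
have [le_pi|lt_ip] := leqP p.+1 i.
  rewrite addnC greedyD //.
  by have := leq_mersenne p.+2 i.+1 le_pi; rewrite (mersenneS p.+1); lia.
have [m def_p] : exists m, p = i + m by exists (p - i); lia.
have le_i : mersenne i.+1 <= mersenne p.+1 by exact: leq_mersenne.
rewrite -addnA [X in _ <= X.+1]greedyD //.
have [le_xi|gt_xi] := leqP (x + mersenne i.+1) (mersenne p.+1).
  rewrite greedyD // ltnS IHx //; have := mersenne_gt0 p; lia.
have defC := mersenneS p.+1.
have -> : mersenne p.+1 + (x + mersenne i.+1) =
  mersenne p.+2 + (x + mersenne i.+1 - (mersenne p.+1).+1) by lia.
rewrite greedyD; last by lia.
by rewrite ltnS; subst p; apply: greedy_carry.
Qed.

(** The greedy terms of w2 are added to w1 one at a time. *)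
Lemma greedy_subadditive w1 w2 : greedy (w1 + w2) <= greedy w1 + greedy w2.
Proof.
elim/mersenne_ind: w2 => [|p x le_x IHx]; first by rewrite !addn0.
rewrite greedyD // [mersenne _ + x]addnC addnA addnS.
apply: leq_trans (greedy_leD_mersenne _ _) _; rewrite ltnS IHx //.
by have := mersenne_gt0 p; lia.
Qed.

(** * Digit sequences of greedy decompositions *)

(** The digit rule of A(n, delta) without the restriction on the top digit. A greedy digit 2 at j
    leaves nothing over, as what remains to be decomposed there is at most c_(j+1) - 1 = 2 c_j. *)
Definition normal (m : nat) (e : nat -> nat) : Prop :=
  forall j, 0 < j <= m ->
    e j <= 2 /\ (e j = 2 -> forall i, 0 < i < j -> e i = 0).

Lemma normal_prefix m e : normal m.+1 e -> normal m e.
Proof. by move=> nf j /andP[j_gt0 le_j]; apply: nf; rewrite j_gt0 leqW. Qed.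

(** A top digit 2 kills all others; a top digit at most 1 gives at most c_(m+1) + 2 c_m = 2 c_(m+1)
    - 1 in the induction step. *)
Lemma normal_weight m e : normal m e ->
  \sum_(1 <= i < m.+1) mersenne i * e i <= (mersenne m).*2.
Proof.
elim: m => [|m IHm] nf; first by rewrite big_geq.
rewrite big_nat_recr //=; have [le2 z2] := nf m.+1 (leqnn _).
have := IHm (normal_prefix _ _ nf); have := mersenneS m.
move: le2 z2; case: (e m.+1) => [|[|[|//]]] _ z2 defC IH; try lia.
rewrite big1_seq ?add0n ?muln2 // => i; rewrite mem_index_iota => lt_i.
by rewrite (z2 _ i) ?muln0.
Qed.

(** By [normal_weight] the digits below a top index m + 1 weigh at most 2 c_m < c_(m+1), so the top
    digit is the greedy quotient or, if it is 2, stands alone. *)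
Lemma greedy_normal m e : normal m e ->
  greedy (\sum_(1 <= i < m.+1) mersenne i * e i) = \sum_(1 <= i < m.+1) e i.
Proof.
elim: m => [|m IHm] nf; first by rewrite !big_geq.
have [le2 z2] := nf m.+1 (leqnn _).
have nf' := normal_prefix _ _ nf; have le_w := normal_weight _ _ nf'.
rewrite !(@big_nat_recr _ _ _ m.+1) //= -(IHm nf'); have defC := mersenneS m.
move: le2 z2; case: (e m.+1) => [|[|[|//]]] _ z2.
- by rewrite muln0 !addn0.
- by rewrite muln1 addn1 addnC greedyD // defC; lia.
rewrite big1_seq; first by rewrite add0n muln2 greedy_mersenne2.
move=> i; rewrite mem_index_iota => lt_i.
by rewrite (z2 _ i) ?muln0.
Qed.

(** Converse of [normal_weight], by greedy choice of the top digit; it supplies the t_i of the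
    theorem. *)
Lemma normal_exists m w : w <= (mersenne m).*2 ->
  exists t, [/\ size t = m, normal m (entry t) &
    \sum_(1 <= i < m.+1) mersenne i * entry t i = w].
Proof.
elim: m w => [|m IHm] w.
  rewrite leqn0 => /eqP->; exists [::]; split=> //; last by rewrite big_geq.
  by move=> j /andP[]; case: j.
have entryl t x i : size t = m -> 0 < i <= m -> entry (rcons t x) i = entry t i.
  by move=> sz_t lt_i; rewrite /entry nth_rcons; case: ltnP => //; lia.
have entryr t x : size t = m -> entry (rcons t x) m.+1 = x.
  by move=> sz_t; rewrite /entry nth_rcons subn1 sz_t ltnn eqxx.
have step w' x : w' <= (mersenne m).*2 -> x <= 2 -> (x = 2 -> w' = 0) ->
    exists t, [/\ size t = m.+1, normal m.+1 (entry t) &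
      \sum_(1 <= i < m.+2) mersenne i * entry t i = w' + mersenne m.+1 * x].
  move=> /IHm[t [sz_t nf_t w_t]] le2 z2; exists (rcons t x).
  have E i : 0 < i <= m -> entry (rcons t x) i = entry t i by exact: entryl.
  split; first by rewrite size_rcons sz_t.
    move=> j /andP[j_gt0]; rewrite leq_eqVlt => /orP[/eqP->|lt_j].
      (* A top digit 2 comes with w' = 0, and then all lower digits vanish because c_i > 0 for i >
         0. *)
      rewrite entryr //; split=> // /z2 w0 i lt_i.
      rewrite E //; move/eqP: w_t; rewrite w0 sum_nat_seq_eq0 => /allP/(_ i).
      rewrite mem_index_iota lt_i => /(_ isT).
      rewrite muln_eq0 => /orP[/eqP|/eqP//].
      by case: i lt_i => // i _; rewrite mersenneS.
    have [|le_j z_j] := nf_t j; first by rewrite j_gt0.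
    rewrite E ?j_gt0 //; split=> // /z_j z i lt_i; rewrite E ?z //.
    by lia.
  rewrite big_nat_recr //= entryr //; congr (_ + _); rewrite -w_t.
  by apply: eq_big_nat => i lt_i; rewrite E.
have defC := mersenneS m; move=> le_w.
have [lt_w|ge_w] := ltnP w (mersenne m.+1).
  have -> : w = w + mersenne m.+1 * 0 by rewrite muln0 addn0.
  by apply: step => //; lia.
have [def_w|ne_w] := eqVneq w (mersenne m.+1).*2.
  have -> : w = 0 + mersenne m.+1 * 2 by lia.
  exact: step.
have -> : w = (w - mersenne m.+1) + mersenne m.+1 * 1 by lia.
by apply: step => //; lia.
Qed.

(** * The generators and their sums along greedy decompositions *)

Definition stride (n k : nat) : nat := (2 ^ k + 1) * 2 ^ n.

Lemma thabit0 n k : thabit n k 0 + mersenne k = stride n k.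
Proof.
rewrite /thabit addn0 -/(mersenne k) -/(stride n k) subnK //.
apply: (@leq_trans (2 ^ k + 1)); first by rewrite /mersenne; lia.
by rewrite /stride leq_pmulr // expn_gt0.
Qed.

Lemma thabitE n k i : thabit n k i = thabit n k 0 + stride n k * mersenne i.
Proof.
have -> : thabit n k i = stride n k * 2 ^ i - mersenne k.
  by rewrite /thabit expnD mulnA.
have -> : 2 ^ i = (mersenne i).+1 by rewrite /mersenne subn1 prednK ?expn_gt0.
by have := thabit0 n k; rewrite mulnS; lia.
Qed.

Lemma thabit0_gt0 n k : 0 < thabit n k 0.
Proof.
rewrite -(ltn_add2r (mersenne k)) thabit0 add0n.
apply: (@leq_trans (2 ^ k + 1)); first by rewrite /mersenne; lia.
by rewrite /stride leq_pmulr // expn_gt0.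
Qed.

(** Both 2 and 2^k + 1 = c_k + 2 are prime to the odd number c_k, and s = a - c_k. *)
Lemma coprime_stride n k : 0 < k -> coprime (stride n k) (thabit n k 0).
Proof.
move=> k_gt0; have co2 : coprime 2 (mersenne k).
  by rewrite coprime2n; case: k k_gt0 => // k _;
    rewrite mersenneS oddS odd_double.
have def2 : 2 ^ k + 1 = mersenne k + 2.
  by rewrite /mersenne; have := expn_gt0 2 k; lia.
have: coprime (stride n k) (mersenne k).
  rewrite /stride coprimeMl def2 coprimeXl // andbT.
  by rewrite /coprime gcdnC gcdnDl gcdnC.
by rewrite -(thabit0 n k) /coprime gcdnC gcdnDr => co;
  rewrite gcdnC gcdnDl gcdnC.
Qed.

(** This is v w, the sum of s_i = s + a c_i over the greedy terms c_i of w. *)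
Definition apery_elt (n k w : nat) : nat :=
  thabit n k 0 * greedy w + stride n k * w.

Lemma apery_elt_normal n k m e : normal m e ->
  \sum_(1 <= i < m.+1) e i * thabit n k i =
    apery_elt n k (\sum_(1 <= i < m.+1) mersenne i * e i).
Proof.
move=> nf; rewrite /apery_elt greedy_normal // !big_distrr -big_split /=.
by apply: eq_bigr => i _; rewrite thabitE; ring.
Qed.

Lemma apery_eltD n k p x : x <= mersenne p.+1 ->
  apery_elt n k (mersenne p.+1 + x) = thabit n k p.+1 + apery_elt n k x.
Proof.
by move=> le_x; rewrite /apery_elt greedyD // (thabitE n k p.+1); ring.
Qed.

Lemma apery_elt_mersenne n k p :
  apery_elt n k (mersenne p.+1) = thabit n k p.+1.
Proof.
by rewrite -[mersenne _]addn0 apery_eltD // /apery_elt !muln0 !addn0.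
Qed.

(** Passing to w + 1 loses at most one s and gains a = s + c_k. *)
Lemma apery_elt_leS n k w : 0 < k -> apery_elt n k w < apery_elt n k w.+1.
Proof.
case: k => // k _; have := greedy_leS w; have := mersenne_gt0 k.
rewrite /apery_elt; have := thabit0 n k.+1; nia.
Qed.

Lemma leq_apery_elt n k w w' :
  0 < k -> w <= w' -> apery_elt n k w <= apery_elt n k w'.
Proof.
move=> k_gt0 /subnK <-; elim: (w' - w) => // d IHd.
by rewrite (leq_trans IHd) // ltnW // apery_elt_leS.
Qed.

(** * A description of all elements of GT(n, k) *)

Lemma GT_submonoid n k : submonoid (GT n k).
Proof.
split; first by move=> S [[S0 _] _].
move=> x y Sx Sy S [monS genS]; apply: monS.2; [exact: Sx | exact: Sy].
Qed.

Lemma GT_thabit n k i : GT n k (thabit n k i).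
Proof. by move=> S [_]; apply; exists i. Qed.

Lemma GT_apery_elt n k q w : GT n k (thabit n k 0 * q + apery_elt n k w).
Proof.
have [GT0 GTD] := GT_submonoid n k; apply: (GTD).
  elim: q => [|q IHq]; first by rewrite muln0.
  by rewrite mulnS; apply: (GTD) => //; apply: GT_thabit.
elim/mersenne_ind: w => [|p x le_x IHx]; first by rewrite /apery_elt !muln0.
rewrite apery_eltD //; apply: (GTD); first exact: GT_thabit.
by apply: IHx; have := mersenne_gt0 p; lia.
Qed.

(** The right-hand set contains s_0 and s_i = v c_i, and is closed under addition: by subadditivity
    v w1 + v w2 exceeds v (w1 + w2) by a nonnegative multiple of s. *)
Lemma GTP n k x :
  GT n k x <-> exists q w, x = thabit n k 0 * q + apery_elt n k w.
Proof.
split=> [GTx|[q [w ->]]]; last exact: GT_apery_elt.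
apply: (GTx [set y | exists q w,
  y = thabit n k 0 * q + apery_elt n k w]%classic).
split; last first.
  move=> _ [[|i] _ <-]; first by exists 1, 0;
    rewrite /apery_elt !muln0 muln1 !addn0.
  exists 0, (mersenne i.+1).
  by rewrite muln0 add0n apery_elt_mersenne.
split; first by exists 0, 0; rewrite /apery_elt !muln0.
move=> _ _ [q1 [w1 ->]] [q2 [w2 ->]].
exists (q1 + q2 + (greedy w1 + greedy w2 - greedy (w1 + w2))), (w1 + w2).
rewrite /apery_elt; move/subnK: (greedy_subadditive w1 w2).
move: (_ - greedy (w1 + w2)) => d def_g.
transitivity (thabit n k 0 * (q1 + q2) + thabit n k 0 * (greedy w1 + greedy w2)
                + stride n k * (w1 + w2)); first by ring.
by rewrite -def_g; ring.
Qed.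

(** * Maximum of the Apery set and Frobenius number *)

Definition apery_max (n k : nat) : nat := apery_elt n k (thabit n k 0).-1.

(** Here v (w + s) - v w = s (g (w + s) + a - g w), and g w <= g (w + s) + s < g (w + s) + a. Hence
    weights from s on give no Apery elements. *)
Lemma apery_elt_large n k w : 0 < k ->
  exists q, apery_elt n k (w + thabit n k 0) =
    thabit n k 0 * q.+1 + apery_elt n k w.
Proof.
case: k => // k _; have := greedy_leD w (thabit n k.+1 0).
have := thabit0 n k.+1; have := mersenne_gt0 k.
set s := thabit n k.+1 0; set a := stride _ _ => b_gt0 def_a le_g.
exists (greedy (w + s) + a - greedy w).-1; rewrite prednK; last by lia.
rewrite /apery_elt -/s -/a addnA -mulnDr subnK; last by lia.
ring.
Qed.

(** As a is invertible modulo s, w' < w would make s divide w - w', which is positive and below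
    s. *)
Lemma residue_unique n k w q w' q' : 0 < k -> w < thabit n k 0 ->
  thabit n k 0 * q + stride n k * w = thabit n k 0 * q' + stride n k * w' ->
  w <= w'.
Proof.
move=> k_gt0 lt_w /(congr1 (modn^~ (thabit n k 0))).
rewrite !(mulnC (thabit n k 0)) !modnMDl => eq_w.
have: stride n k * w == stride n k * w' %[mod thabit n k 0] by apply/eqP.
case: (leqP w w') => // lt_w'; rewrite eqn_mod_dvd ?leq_mul2l 1?ltnW ?orbT //.
rewrite -mulnBr Gauss_dvdr; last by rewrite coprime_sym coprime_stride.
by move/dvdn_leq; rewrite subn_gt0 lt_w' => /(_ isT); lia.
Qed.

Lemma residue_exists n k x : 0 < k ->
  exists2 w, w < thabit n k 0 & stride n k * w = x %[mod thabit n k 0].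
Proof.
move=> k_gt0; have s_gt0 := thabit0_gt0 n k.
have a_gt0 : 0 < stride n k by rewrite -thabit0 addn_gt0 s_gt0.
(* The Bezout coefficient u inverts a modulo s. *)
case: (egcdnP (thabit n k 0) a_gt0) => u v def_u _.
exists ((u * x) %% thabit n k 0); first by rewrite ltn_mod.
have /eqP co := coprime_stride n k k_gt0.
by rewrite modnMmr mulnA [_ * u]mulnC def_u co mulnDl mul1n mulnAC modnMDl.
Qed.

(** From x = s q + v w, [residue_unique] gives s - 1 <= w, so v (s - 1) <= v w <= x by monotonicity,
    although x = v (s - 1) - s. *)
Lemma apery_max_notin n k x : 0 < k ->
  apery_max n k = x + thabit n k 0 -> ~ GT n k x.
Proof.
move=> k_gt0 def_x /GTP[q [w def_w]]; have s_gt0 := thabit0_gt0 n k.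
have: apery_max n k = thabit n k 0 * q.+1 + apery_elt n k w.
  by rewrite def_x def_w mulnS; ring.
rewrite {1}/apery_max {1}/apery_elt {1}/apery_elt addnA -mulnDr => eq_w.
have le_w : (thabit n k 0).-1 <= w.
  by apply: residue_unique k_gt0 _ eq_w; rewrite prednK.
have := leq_apery_elt n k _ _ k_gt0 le_w; rewrite -/(apery_max n k) def_x def_w.
by lia.
Qed.

(** An Apery element s q + v w must have q = 0, and w < s by [apery_elt_large]; then v is
    increasing. *)
Lemma is_max_apery n k : 0 < k ->
  is_max (Apery (GT n k) (thabit n k 0)) (apery_max n k).
Proof.
move=> k_gt0; have s_gt0 := thabit0_gt0 n k; split.
  split; first by have := GT_apery_elt n k 0 (thabit n k 0).-1; rewrite muln0.
  move=> [x GTx def_x]; apply: (@apery_max_notin n k x) => //.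
  by lia.
move=> _ [/GTP[[|q] [w ->]] notin].
  rewrite muln0 add0n in notin *; have [lt_w|ge_w] := ltnP w (thabit n k 0).
    by apply: leq_apery_elt => //; rewrite -ltnS prednK.
  have [q def_q] := @apery_elt_large n k (w - thabit n k 0) k_gt0.
  rewrite subnK // in def_q; case: notin; rewrite def_q.
  exists (thabit n k 0 * q + apery_elt n k (w - thabit n k 0)).
    exact: GT_apery_elt.
  by rewrite mulnS; lia.
case: notin; exists (thabit n k 0 * q + apery_elt n k w).
  exact: GT_apery_elt.
by rewrite mulnS; lia.
Qed.

(** For y > M - s, some w < s has v w congruent to y + s modulo s. As v w <= M < y + s, the
    difference is a positive multiple of s, and removing one s puts y in GT(n, k). *)
Lemma is_Frobenius_GT n k : 0 < k ->
  is_Frobenius (GT n k) ((apery_max n k)%:Z - (thabit n k 0)%:Z)%R.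
Proof.
move=> k_gt0; have s_gt0 := thabit0_gt0 n k; split.
  by case: (is_max_apery n k k_gt0) => -[].
move=> y notin; rewrite Order.TotalTheory.leNgt; apply/negP => lt_y.
apply: notin.
have [z def_z] : exists z : nat, (y + (thabit n k 0)%:Z)%R = Posz z.
  by exists `|(y + (thabit n k 0)%:Z)%R|%N; lia.
have lt_z : apery_max n k < z by lia.
have [w lt_w mod_w] := residue_exists n k z k_gt0.
have le_w : apery_elt n k w <= apery_max n k.
  by apply: leq_apery_elt => //; rewrite -ltnS prednK.
have lt_wz : apery_elt n k w < z by exact: leq_ltn_trans le_w lt_z.
have: thabit n k 0 %| z - apery_elt n k w.
  rewrite -eqn_mod_dvd ?(ltnW lt_wz) // /apery_elt mulnC modnMDl.
  by apply/eqP; rewrite mod_w.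
case/dvdnP=> -[|q] def_q; first by lia.
exists (thabit n k 0 * q + apery_elt n k w); first exact: GT_apery_elt.
by move: def_q; rewrite mulSn mulnC; lia.
Qed.

(** * The target weight s - 1 and the digit patterns of the cases *)

Lemma thabit0_pred n k : (thabit n k 0).-1 + 2 ^ k = 2 ^ (n + k) + 2 ^ n.
Proof.
have := thabit0 n k; have := thabit0_gt0 n k; have := expn_gt0 2 k.
rewrite /mersenne /stride mulnDl mul1n expnD [2 ^ k * _]mulnC; lia.
Qed.

Lemma apery_max_normal n k m e : normal m e ->
  \sum_(1 <= i < m.+1) mersenne i * e i = (thabit n k 0).-1 ->
  apery_max n k = \sum_(1 <= i < m.+1) e i * thabit n k i.
Proof. by move=> nf def_w; rewrite apery_elt_normal // def_w. Qed.

(** [G] takes the index and the digit, so that one lemma serves both the weights and the sums of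
    generators. *)
Lemma sum_entry_cat (G : nat -> nat -> nat) t u :
  \sum_(1 <= i < (size (t ++ u)).+1) G i (entry (t ++ u) i) =
    \sum_(1 <= i < (size t).+1) G i (entry t i) +
    \sum_(1 <= i < (size u).+1) G (size t + i) (entry u i).
Proof.
rewrite size_cat (@big_cat_nat _ _ _ (size t).+1) //= ?ltnS ?leq_addr //.
congr (_ + _).
  apply: eq_big_nat => -[//|i] /= lt_i.
  by rewrite /entry nth_cat subn1 /= -ltnS lt_i.
rewrite -[(size t).+1]add1n big_addn.
rewrite (_ : (size t + size u).+1 - size t = (size u).+1); last by lia.
apply: eq_big_nat => i /andP[i_gt0 _].
rewrite addnC; congr (G _ _); rewrite /entry nth_cat.
rewrite ifF; last by lia.
by rewrite -addnBA // addKn.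
Qed.

Lemma admissible_normal n d t : admissible n d t -> normal (n + d) (entry t).
Proof.
move=> [_ le2 _ z2] j lt_j; split; last exact: z2.
by have := le2 _ lt_j; rewrite !inE => /or3P[]/eqP->.
Qed.

(** Digits 0 and 1 on top never trigger the rule on 2, and a nonempty u settles the top digit. *)
Lemma normal_cat_admissible n d t u :
  size t + size u = n + d -> 0 < size u -> {subset u <= [:: 0; 1]} ->
  normal (size t) (entry t) -> admissible n d (t ++ u).
Proof.
move=> sz u_gt0 u01 nf.
have entryl i : 0 < i <= size t -> entry (t ++ u) i = entry t i.
  by case: i => // i lt_i; rewrite /entry nth_cat subn1 ifT.
have entryr i : size t < i <= n + d -> entry (t ++ u) i \in [:: 0; 1].
  move=> lt_i; apply: u01; rewrite /entry nth_cat ifF; last by lia.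
  by rewrite mem_nth //; lia.
split; first by rewrite size_cat.
- move=> j /andP[j_gt0 le_j]; have [le_jt|lt_tj] := leqP j (size t).
    rewrite entryl ?j_gt0 //; have [] := nf j; first by rewrite j_gt0.
    by case: (entry t j) => [|[|[|]]].
  have := entryr j; rewrite lt_tj le_j => /(_ isT).
  by rewrite !inE => /orP[]->; rewrite ?orbT.
- by apply: entryr; lia.
move=> j /andP[j_gt0 le_j]; have [le_jt|lt_tj] := leqP j (size t).
  rewrite entryl ?j_gt0 // => e2 i lt_i; rewrite entryl; last by lia.
  have [|_ z2] := nf j; first by rewrite j_gt0.
  exact: z2 e2 i lt_i.
have := entryr j; rewrite lt_tj le_j => /(_ isT).
by rewrite !inE => /orP[]/eqP->.
Qed.

(** The pattern for 2 <= k < n; this [n] is n - 2 in the theorem. *)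
Lemma sum_entry_spike (G : nat -> nat -> nat) n k t :
  (forall i, G i 0 = 0) -> size t = n ->
  \sum_(1 <= i < (n.+2 + k).+1)
    G i (entry (t ++ [:: 1] ++ nseq k 0 ++ [:: 1]) i) =
    \sum_(1 <= i < n.+1) G i (entry t i) + G n.+1 1 + G (n.+2 + k) 1.
Proof.
move=> G0 sz_t.
have def_m : n.+2 + k = size (t ++ [:: 1] ++ nseq k 0 ++ [:: 1]).
  by rewrite !size_cat size_nseq sz_t /=; lia.
rewrite [in LHS]def_m sum_entry_cat (sum_entry_cat (fun i => G (size t + i))).
rewrite (sum_entry_cat (fun i => G (size t + (size [:: 1] + i)))).
rewrite !big_nat1 size_nseq sz_t [X in _ + (_ + (X + _))]big1_seq.
  by rewrite add0n addnA /=; congr (_ + G _ _ + G _ _); lia.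
by move=> i _; rewrite /entry nth_nseq if_same G0.
Qed.

(** The pattern for k > n; this [k] is k - 1 in the theorem. *)
Lemma sum_entry_block (G : nat -> nat -> nat) n k t :
  size t = k ->
  \sum_(1 <= i < (n + k).+1) G i (entry (t ++ nseq n 1) i) =
    \sum_(1 <= i < k.+1) G i (entry t i) + \sum_(k.+1 <= i < n + k.+1) G i 1.
Proof.
move=> sz_t.
have def_m : n + k = size (t ++ nseq n 1).
  by rewrite !size_cat size_nseq sz_t addnC.
rewrite [in LHS]def_m sum_entry_cat sz_t size_nseq; congr (_ + _).
rewrite -[k.+1]add1n big_addn (_ : n + (1 + k) - k = n.+1); last by lia.
apply: eq_big_nat => i lt_i; rewrite addnC /entry nth_nseq ifT //.
by lia.
Qed.

(** The block of ones weighs 2^(n+k) - 2^k - n, which leaves 2^n + n of s - 1 for the t_i. *)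
Lemma sum_mersenne k n :
  \sum_(k <= i < n + k) mersenne i + n + 2 ^ k = 2 ^ (n + k).
Proof.
elim: n => [|n IHn]; first by rewrite big_geq.
rewrite addSn big_nat_recr ?leq_addl //= expnS.
by have := expn_gt0 2 (n + k); rewrite {2}/mersenne; lia.
Qed.

Theorem theorem5p1 (n k : nat) (hk : k <> 0) :
  exists (M : nat) (F : int),
    is_max (Apery (GT n k) (thabit n k 0)) M /\
    is_Frobenius (GT n k) F /\
    F = (M%:Z - (thabit n k 0)%:Z)%R /\
    (n = 0 ->
       M = thabit n k 1 /\ F = ((thabit n k 1)%:Z - 2)%R) /\
    (n <> 0 -> k = 1 ->
       M = thabit n k n + thabit n k (n + 1) /\
       F = ((thabit n k n)%:Z + (thabit n k (n + 1))%:Z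
            - (thabit n k 0)%:Z)%R) /\
    (2 <= k < n ->
       let P (t : seq nat) :=
         size t = n - 2 /\
         admissible n (delta n k) (t ++ [:: 1] ++ nseq k 0 ++ [:: 1]) /\
         \sum_(1 <= i < n - 1) (2 ^ i - 1) * entry t i
           = 2 ^ (n - 1) - 2 ^ k + 2 in
       (exists t, P t) /\
       forall t, P t ->
         M = \sum_(1 <= i < n - 1) entry t i * thabit n k i
             + thabit n k (n - 1) + thabit n k (n + k) /\
         F = ((\sum_(1 <= i < n - 1) entry t i * thabit n k i)%N%:Z
              + (thabit n k (n - 1))%:Z + (thabit n k (n + k))%:Z
              - (thabit n k 0)%:Z)%R) /\
    (n = k -> 1 <= k ->
       M = thabit n k 1 + thabit n k (2 * n) /\
       F = ((thabit n k 1)%:Z + (thabit n k (2 * n)%N)%:Z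
            - (thabit n k 0)%:Z)%R) /\
    (n <> 0 -> n < k -> k <> 2 ->
       let P (t : seq nat) :=
         size t = k - 1 /\
         admissible n (delta n k) (t ++ nseq n 1) /\
         \sum_(1 <= i < k) (2 ^ i - 1) * entry t i = 2 ^ n + n in
       (exists t, P t) /\
       forall t, P t ->
         M = \sum_(1 <= i < k) entry t i * thabit n k i
             + \sum_(k <= i < n + k) thabit n k i /\
         F = ((\sum_(1 <= i < k) entry t i * thabit n k i)%N%:Z
              + (\sum_(k <= i < n + k) thabit n k i)%N%:Z
              - (thabit n k 0)%:Z)%R) /\
    (n = 1 -> k = 2 -> M = 74 /\ (F = 67)%R).
Proof.
have k_gt0 : 0 < k by rewrite lt0n; apply/eqP.
have s_pred := thabit0_pred n k.
exists (apery_max n k), ((apery_max n k)%:Z - (thabit n k 0)%:Z)%R.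
split; first exact: is_max_apery.
split; first exact: is_Frobenius_GT.
split=> //; split.
  move=> n0; suff def_M : apery_max n k = thabit n k 1.
    split=> //; rewrite def_M; congr (_ - Posz _)%R.
    by rewrite n0 add0n in s_pred *; have := thabit0_gt0 0 k; lia.
  (* For n = 0, s = 2. *)
  rewrite /apery_max (_ : (thabit n k 0).-1 = mersenne 1).
    exact: apery_elt_mersenne.
  by rewrite n0 add0n in s_pred *; rewrite /mersenne; lia.
split.
  move=> /eqP; rewrite -lt0n => n_gt0 k1.
  suff def_M : apery_max n k = thabit n k n + thabit n k (n + 1).
    by split=> //; rewrite def_M PoszD.
  have [m def_n] : exists m, n = m.+1 by exists n.-1; rewrite prednK.
  (* For k = 1, s - 1 = 2^(n+1) + 2^n - 2 = c_(n+1) + c_n. *)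
  rewrite /apery_max (_ : (thabit n k 0).-1 = mersenne m.+2 + mersenne m.+1).
    rewrite apery_eltD ?leq_mersenne // apery_elt_mersenne addnC def_n addn1 //.
  have := expn_gt0 2 m.+1; have := expnS 2 m.+1; move: s_pred.
  by rewrite k1 def_n addn1 /mersenne; lia.
split.
  move=> lt_kn P; have d_def : delta n k = k.
    by rewrite /delta; case: eqP => [|_]; [lia | rewrite ifT //; lia].
  have [m def_n] : exists m, n = m.+2 by exists n.-2; lia.
  have [m1 m2] : n - 2 = m /\ n - 1 = m.+1 by lia.
  rewrite {}/P d_def m1 m2.
  (* This makes the truncated subtraction 2^(n-1) - 2^k exact; 2^k >= 4 then bounds the weight by 2
     c_(n-2) = 2^(n-1) - 2. *)
  have le_k : 2 ^ k <= 2 ^ m.+1 by rewrite leq_exp2l //; lia.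
  have ge_k : 2 ^ 2 <= 2 ^ k by rewrite leq_exp2l //; lia.
  have dm := mersenneS m; have def_m := expnS 2 m; have def_m1 := expnS 2 m.+1.
  split.
    have [|t [sz_t nf_t w_t]] := @normal_exists m (2 ^ m.+1 - 2 ^ k + 2).
      by rewrite /mersenne; have := expn_gt0 2 m; lia.
    exists t; split=> //; split=> //; apply: normal_cat_admissible.
    - by rewrite !size_cat size_nseq sz_t /=; lia.
    - by rewrite !size_cat /=; lia.
    - by move=> i; rewrite !mem_cat mem_nseq !inE => /or3P[->|/andP[_ ->]|->];
        rewrite ?orbT.
    - by rewrite sz_t.
  move=> t [sz_t [/admissible_normal nf w_t]].
  suff def_M : apery_max n k = \sum_(1 <= i < m.+1) entry t i * thabit n k i
      + thabit n k m.+1 + thabit n k (n + k).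
    by split=> //; rewrite def_M !PoszD.
  rewrite (apery_max_normal _ _ _ _ nf) def_n.
    by rewrite (sum_entry_spike (fun i x => x * thabit _ k i)) // !mul1n.
  rewrite (sum_entry_spike (fun i x => mersenne i * x)) //; last first.
    by move=> i; rewrite muln0.
  have := expn_gt0 2 (m.+2 + k); move: s_pred; rewrite w_t def_n !muln1.
  by rewrite /mersenne; lia.
split.
  move=> nk _; have [m def_n] : exists m, n = m.+1 by exists n.-1; lia.
  have [p def_p] : exists p, 2 * n = p.+1 by exists (2 * n).-1; lia.
  suff def_M : apery_max n k = thabit n k 1 + thabit n k (2 * n).
    by split=> //; rewrite def_M PoszD.
  (* For n = k, s - 1 = 2^(2n) = c_(2n) + c_1. *)
  rewrite /apery_max (_ : (thabit n k 0).-1 = mersenne p.+1 + mersenne 1).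
    by rewrite apery_eltD ?leq_mersenne // apery_elt_mersenne addnC def_p.
  have := expn_gt0 2 p.+1; move: s_pred.
  by rewrite -nk addnn -mul2n def_p /mersenne; lia.
split.
  move=> /eqP; rewrite -lt0n => n_gt0 lt_nk k_neq2 P.
  have d_def : delta n k = k - 1.
    by rewrite /delta; case: eqP => [|_]; [lia | rewrite ifF //; lia].
  have [j def_k] : exists j, k = j.+1 by exists k.-1; lia.
  have j1 : k - 1 = j by lia.
  rewrite {}/P d_def j1.
  split.
    have [|t [sz_t nf_t w_t]] := @normal_exists j (2 ^ n + n).
      have le_n : 2 ^ n <= 2 ^ j by rewrite leq_exp2l //; lia.
      (* The bound 2^n + n <= 2 c_j follows from n <= j and j + 2 <= 2^j; the latter holds from j =
         2 on, hence k <> 2. *)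
      have [i def_j] : exists i, j = i.+2 by exists j.-2; lia.
      rewrite -mul2n /mersenne def_j; have := ltn_expl i (ltnSn 1).
      by have := expnS 2 i; have := expnS 2 i.+1; rewrite def_j in le_n; lia.
    exists t; split=> //; split; last by rewrite def_k.
    apply: normal_cat_admissible.
    - by rewrite size_nseq sz_t addnC.
    - by rewrite size_nseq.
    - by move=> i; rewrite mem_nseq !inE => /andP[_ ->]; rewrite orbT.
    - by rewrite sz_t.
  move=> t [sz_t [/admissible_normal nf w_t]].
  suff def_M : apery_max n k = \sum_(1 <= i < k) entry t i * thabit n k i
      + \sum_(k <= i < n + k) thabit n k i.
    by split=> //; rewrite def_M !PoszD.
  rewrite def_k in w_t; rewrite (apery_max_normal _ _ _ _ nf).
    rewrite (sum_entry_block (fun i x => x * thabit _ k i)) // -def_k.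
    by congr (_ + _); apply: eq_bigr => i _; rewrite mul1n.
  rewrite (sum_entry_block (fun i x => mersenne i * x)) // w_t -def_k.
  rewrite (eq_bigr mersenne) => [|i _]; last by rewrite muln1.
  have := sum_mersenne k n; lia.
move=> n1 k2; suff def_M : apery_max n k = 74
  by split=> //; rewrite def_M n1 k2.
(* By computation: s - 1 = 6 = 2 c_2 and M = 2 s_2 = 2 * 37. The top digit 2 is not allowed in A(1,
   1), hence the separate case. *)
by rewrite n1 k2.
Qed.
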